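(* Let $X$ and $Y$ be Banach spaces and let $H\subseteq L(X^*,Y)$ be a closed subspace such that $X\otimes Y\subseteq H$. Assume that each $T\in H$ is weak$^*$-to-weakly continuous. Then: (i) If $X$ and $Y$ are octahedral, then $H$ is octahedral. (ii) If $X$ is octahedral and there exists $y\in S_Y$ such that $n(Y,y)=1$, then $H$ is octahedral.
   Context: All Banach spaces are real and non-zero. $B_X$ and $S_X$ denote the closed unit ball and the unit sphere of $X$. $L(X^*,Y)$ is the Banach space of bounded linear operators from $X^*$ to $Y$ with the operator norm. The algebraic tensor product $X\otimes Y$ is viewed inside $L(X^*,Y)$ by letting $x\otimes y$ act as $x^*\mapsto x^*(x)\,y$. Weak$^*$-to-weakly continuous means continuous from $(X^*,w^* )$ to $(Y,w)$. A Banach space $X$ is octahedral (OH) if for every $x_1,\ldots,x_n\in S_X$ and $\varepsilon>0$ there exists $y\in S_X$ such that $\|x_i+y\|>2-\varepsilon$ for all $i\in\{1,\ldots,n\}$. For a Banach space $X$ and $u\in S_X$, put $D(X,u):=\{f\in B_{X^*}: f(u)=1\}$, and let $n(X,u)$ be the largest non-negative real number $k$ satisfying $k\|x\|\le \sup\{|f(x)|: f\in D(X,u)\}$ for all $x\in X$. (Thus $n(X,u)=1$ if and only if $D(X,u)$ is a norming subset for $X$.) *)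

(* Defs.v *)
From HB Require Import structures.
From mathcomp Require Import all_boot all_order all_algebra.
From mathcomp Require Import all_classical all_reals all_analysis.

Set Implicit Arguments.
Unset Strict Implicit.
Unset Printing Implicit Defensive.

Import Order.TTheory GRing.Theory Num.Theory.
Import numFieldNormedType.Exports.

Local Open Scope classical_set_scope.
Local Open Scope ring_scope.

Section BoundedOperators.
Context {R : realType} {V W : normedModType R}.
Implicit Types f g : V -> W.

Definition bounded_operator : {pred V -> W} :=
  [pred f | `[< linear f /\ exists M : R, forall x, `|f x| <= M * `|x| >]].

Definition opnorm f : R := sup [set `|f x| | x in [set x | `|x| <= 1]].

Lemma bounded_operatorP f :
  reflect (linear f /\ exists M : R, forall x, `|f x| <= M * `|x|)
          (f \in bounded_operator).
Proof. by rewrite inE; exact: asboolP. Qed.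

Fact bounded_operator_submod_closed : submod_closed bounded_operator.
Proof.
split=> [|a f g /bounded_operatorP[lf [M fM]] /bounded_operatorP[lg [N gN]]].
  apply/bounded_operatorP; split=> [a u v|]; first by rewrite /= scaler0 addr0.
  by exists 0 => x; rewrite normr0 mul0r.
apply/bounded_operatorP; split=> [b u v|].
  have -> : forall x, (a *: f + g) x = a *: f x + g x by [].
  rewrite lf lg !scalerDr !scalerA (mulrC a b) -!addrA; congr (_ + _).
  by rewrite addrCA.
exists (`|a| * M + N) => x.
apply: (le_trans (ler_normD _ _)); rewrite mulrDl lerD//.
by rewrite normrZ -mulrA ler_wpM2l.
Qed.

HB.instance Definition _ :=
  GRing.isSubmodClosed.Build R (V -> W) bounded_operator
    bounded_operator_submod_closed.

End BoundedOperators.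

Arguments bounded_operator {R} V W.

Record bop (R : realType) (V W : normedModType R) := Bop {
  bop_fun :> V -> W ;
  _ : bop_fun \in bounded_operator V W }.

Notation "''L' ( V , W )" := (bop V W)
  (at level 8, format "''L' ( V ,  W )") : type_scope.

HB.instance Definition _ (R : realType) (V W : normedModType R) :=
  [isSub for @bop_fun R V W].
HB.instance Definition _ (R : realType) (V W : normedModType R) :=
  [Choice of 'L(V, W) by <:].
HB.instance Definition _ (R : realType) (V W : normedModType R) :=
  [SubChoice_isSubLmodule of 'L(V, W) by <:].

Section OperatorNorm.
Context {R : realType} {V W : normedModType R}.
Implicit Types T S : 'L(V, W).

Fact bop_linear T : linear T.
Proof. by case: T => f /= /bounded_operatorP[]. Qed.

HB.instance Definition _ T := GRing.isLinear.Build R V W *:%R T (bop_linear T).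

Lemma opnorm_has_sup T : has_sup [set `|T x| | x in [set x | `|x| <= 1]].
Proof.
split; first by exists `|T 0|, 0 => //=; rewrite normr0.
have [_ [M TM]] := bounded_operatorP _ (valP T).
exists `|M| => _ [x /= x1 <-]; apply: (le_trans (TM x)).
apply: (le_trans (ler_norm _)); rewrite normrM normr_id.
by rewrite -[leRHS]mulr1 ler_wpM2l.
Qed.

Lemma opnorm_ge0 T : 0 <= opnorm T.
Proof.
apply: (@le_trans _ _ `|T 0|) => //; apply: ub_le_sup; last first.
  by exists 0 => //=; rewrite normr0.
by have [] := opnorm_has_sup T.
Qed.

Lemma le_opnorm T x : `|T x| <= opnorm T * `|x|.
Proof.
have [->|x0] := eqVneq x 0; first by rewrite raddf0 !normr0 mulr0.
rewrite -ler_pdivrMr ?normr_gt0//; apply: ub_le_sup.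
  by have [] := opnorm_has_sup T.
exists (`|x|^-1 *: x) => /=.
  by rewrite normrZ normfV normr_id mulVf ?normr_eq0.
by rewrite linearZ/= normrZ normfV normr_id mulrC.
Qed.

Lemma opnorm_le T (M : R) :
  0 <= M -> (forall x, `|T x| <= M * `|x|) -> opnorm T <= M.
Proof.
move=> M0 TM; apply: ge_sup; first by have [] := opnorm_has_sup T.
move=> _ [x /= x1 <-]; apply: (le_trans (TM x)).
by rewrite -[leRHS]mulr1 ler_wpM2l.
Qed.

Fact ler_opnormD T S : opnorm (T + S : 'L(V, W)) <= opnorm T + opnorm S.
Proof.
apply: opnorm_le => [|x]; first by rewrite addr_ge0 ?opnorm_ge0.
apply: (le_trans (ler_normD _ _)).
by rewrite mulrDl lerD// le_opnorm.
Qed.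

Fact opnormZ (a : R) T : opnorm (a *: T : 'L(V, W)) = `|a| * opnorm T.
Proof.
have le b S : opnorm (b *: S : 'L(V, W)) <= `|b| * opnorm S.
  apply: opnorm_le => [|x]; first by rewrite mulr_ge0 ?opnorm_ge0.
  have -> : (b *: S : 'L(V, W)) x = b *: S x by [].
  by rewrite normrZ -mulrA ler_wpM2l ?le_opnorm.
apply/eqP; rewrite eq_le le andTb.
have [->|a0] := eqVneq a 0; first by rewrite normr0 mul0r opnorm_ge0.
rewrite mulrC -ler_pdivlMr ?normr_gt0// mulrC -normfV.
by rewrite -{1}[T](scalerK a0) le.
Qed.

Fact opnorm0_eq0 T : opnorm T = 0 -> T = 0.
Proof.
move=> T0; apply/val_inj/funext => x /=; apply/eqP.
by rewrite -normr_le0 (le_trans (le_opnorm T x))// T0 mul0r.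
Qed.

HB.instance Definition _ := Lmodule_isNormed.Build R 'L(V, W)
  ler_opnormD opnormZ opnorm0_eq0.

End OperatorNorm.

(* The topological dual: the scalar field R is a normed module over itself
   under the alias R^o. *)
Definition dual {R : realType} (V : normedModType R) : normedModType R :=
  'L(V, R^o).

Section WeakTopologies.
Context {R : realType}.
Implicit Types V W : normedModType R.

(* The initial topologies for evaluation into a power of R. *)
Definition weak_star V : topologicalType :=
  initial_topology (fun f : dual V => (f : {ptws V -> R^o})).

Definition weak V : topologicalType :=
  initial_topology (fun v : V => (fun f => f v) : {ptws dual V -> R^o}).

Definition weak_star_to_weak_continuous V W (T : 'L(dual V, W)) : Prop :=
  continuous (T : weak_star V -> weak W).

End WeakTopologies.

Section TensorProduct.
Context {R : realType} {X Y : normedModType R}.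

Definition elem_tensor_fun (x : X) (y : Y) (f : dual X) : Y := f x *: y.

Fact elem_tensor_bounded (x : X) (y : Y) :
  elem_tensor_fun x y \in bounded_operator (dual X) Y.
Proof.
apply/bounded_operatorP; split=> [a f g|].
  by rewrite /elem_tensor_fun/= scalerDl scalerA.
exists (`|x| * `|y|) => f; rewrite /elem_tensor_fun normrZ mulrAC.
by rewrite ler_wpM2r// mulrC le_opnorm.
Qed.

Definition elem_tensor (x : X) (y : Y) : 'L(dual X, Y) :=
  Bop (elem_tensor_bounded x y).

End TensorProduct.

(* The algebraic tensor product, as the set of finite sums of elementary
   tensors inside the operators from the dual of X to Y. *)
Definition tensor_product {R : realType} (X Y : normedModType R) :
    set 'L(dual X, Y) :=
  [set T | exists (n : nat) (x : 'I_n -> X) (y : 'I_n -> Y),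
    T = \sum_(i < n) elem_tensor (x i) (y i)].

Arguments tensor_product {R} X Y _.

Definition linear_subspace {R : realType} {V : normedModType R}
    (E : set V) : Prop :=
  E 0 /\ forall (a : R) (u v : V), E u -> E v -> E (a *: u + v).

(* For a linear subspace E with the norm inherited from V; the whole space V
   is octahedral when [set: V] is. *)
Definition octahedral {R : realType} {V : normedModType R}
    (E : set V) : Prop :=
  forall (n : nat) (x : 'I_n -> V) (e : R),
    (forall i, E (x i) /\ `|x i| = 1) -> 0 < e ->
    exists y : V, [/\ E y, `|y| = 1 & forall i, 2 - e < `|x i + y|].

Section NumericalIndex.
Context {R : realType} {V : normedModType R}.
Implicit Type u : V.

Definition states u : set (dual V) := [set f : dual V | `|f| <= 1 /\ f u = 1].

Definition numerical_index_set u : set R :=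
  [set k | 0 <= k /\
           forall x : V, k * `|x| <= sup [set `|f x| | f in states u]].

(* For u of norm 1 this supremum is attained: see numerical_index_largest. *)
Definition numerical_index u : R := sup (numerical_index_set u).

Lemma numerical_index_largest u : `|u| = 1 ->
  numerical_index_set u (numerical_index u) /\
  ubound (numerical_index_set u) (numerical_index u).
Proof.
move=> u1.
have sup_ge0 (A : set R) : (forall a, A a -> 0 <= a) -> 0 <= sup A.
  move=> A0; have [[[a Aa] ubA]|/sup_out->//] := pselect (has_sup A).
  by apply: (le_trans (A0 a Aa)); exact: ub_le_sup.
have sup0 x : 0 <= sup [set `|f x| | f in states u].
  by apply: sup_ge0 => _ [f _ <-].
have ubN : ubound (numerical_index_set u) (sup [set `|f u| | f in states u]).
  by move=> k [_ /(_ u)]; rewrite u1 mulr1.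
have N0 : numerical_index_set u 0 by split=> // x; rewrite mul0r.
have ubS : has_ubound (numerical_index_set u) by eexists; exact: ubN.
split; last by move=> k kN; apply: ub_le_sup.
split=> [|x]; first exact: ub_le_sup.
have [->|x0] := eqVneq x 0; first by rewrite normr0 mulr0.
rewrite -ler_pdivlMr ?normr_gt0//; apply: ge_sup; first by exists 0.
by move=> k [_ kx]; rewrite ler_pdivlMr ?normr_gt0.
Qed.

End NumericalIndex.

(* Main.v *)
(* The octahedral direction is an elementary tensor x (x) y. Since each T_i is
   weak*-to-weakly continuous, g o T_i is evaluation at some u_i in X for every
   g in the dual of Y; choosing g = g_i in a norming set makes u_i nearly of
   norm 1, and octahedrality of X gives a unit vector x with |u_i + x| near 2.
   If all the g_i can be taken with g_i y = 1, applying g_i yields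
   |T_i + x (x) y| >= |u_i + x|. Otherwise take z_i norming u_i + x, so that
   z_i x and |T_i z_i| are near 1, and let y be the unit vector that
   octahedrality of Y provides for the vectors T_i z_i; evaluation at z_i
   concludes. *)
From HB Require Import structures.
Require Import Defs.
From mathcomp Require Import all_boot all_order all_algebra.
From mathcomp Require Import all_classical all_reals all_analysis.
From mathcomp Require Import lra.

Set Implicit Arguments.
Unset Strict Implicit.
Unset Printing Implicit Defensive.

Import Order.TTheory GRing.Theory Num.Theory.
Import numFieldNormedType.Exports.

Local Open Scope classical_set_scope.
Local Open Scope ring_scope.

(** * Sublinear functionals and the Hahn-Banach theorem *)

Definition sublinear {R : realType} {V : lmodType R} (p : V -> R) : Prop :=
  (forall x y, p (x + y) <= p x + p y) /\
  (forall (t : R) x, 0 <= t -> p (t *: x) <= t * p x).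

Lemma sublinearZ (R : realType) (V : lmodType R) (p : V -> R) (t : R) (x : V) :
  sublinear p -> 0 <= t -> p (t *: x) = t * p x.
Proof.
move=> [pD pZ] t0; apply/eqP; rewrite eq_le pZ//=.
move: t0; rewrite [0 <= t]le_eqVlt => /predU1P[<-|t0].
  by rewrite mul0r scale0r; have := pD 0 0; rewrite addr0; lra.
rewrite -ler_pdivlMl// -{1}[x](scalerK (lt0r_neq0 t0)).
by rewrite pZ// invr_ge0 ltW.
Qed.

Lemma sublinear0 (R : realType) (V : lmodType R) (p : V -> R) :
  sublinear p -> p 0 = 0.
Proof. by move=> sp; rewrite -(scale0r 0) sublinearZ// mul0r. Qed.

Lemma sublinear_ge_opp (R : realType) (V : lmodType R) (p : V -> R) (x : V) :
  sublinear p -> - p (- x) <= p x.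
Proof.
by move=> sp; have := sp.1 x (- x); rewrite subrr sublinear0//; lra.
Qed.

(** Oddness reverses subadditivity: [p (t *: x) <= p (t *: x + y) + p (- y)] and
    [p (- y) = - p y]. *)
Lemma sublinear_odd_linear (R : realType) (V : lmodType R) (p : V -> R) :
  sublinear p -> (forall x, p (- x) <= - p x) -> linear (p : V -> R^o).
Proof.
move=> sp oddp.
have pN x : p (- x) = - p x.
  apply/eqP; rewrite eq_le oddp/=.
  by have := sublinear_ge_opp (- x) sp; rewrite opprK; lra.
have pZ t x : p (t *: x) = t * p x.
  have [t0|t0] := leP 0 t; first exact: sublinearZ.
  rewrite -[t *: x]opprK -scaleNr pN sublinearZ//; last by rewrite oppr_ge0 ltW.
  by rewrite mulNr opprK.
move=> t x y; rewrite -(pZ t x : _ = t *: (p x : R^o)).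
apply/eqP; rewrite eq_le sp.1/=.
by have := sp.1 (t *: x + y) (- y); rewrite addrK pN; lra.
Qed.

Lemma le_mul_inf (R : realType) (A : set R) (s c : R) :
  0 <= s -> A !=set0 -> (forall a, A a -> c <= s * a) -> c <= s * inf A.
Proof.
rewrite [0 <= s]le_eqVlt => /predU1P[<-|s0] A0 cA.
  by case: A0 => a /cA; rewrite !mul0r.
rewrite -ler_pdivrMl//; apply: lb_le_inf => // a /cA.
by rewrite -ler_pdivrMl.
Qed.

(* The largest sublinear functional q <= p with q (- y) <= - p y. *)
Definition tilt {R : realType} {V : lmodType R} (p : V -> R) (y x : V) : R :=
  inf [set p (x + t *: y) - t * p y | t in [set t : R | 0 <= t]].

Section Tilt.
Context {R : realType} {V : lmodType R} (p : V -> R) (y : V).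
Hypothesis sp : sublinear p.

Lemma tilt_lbound x t : 0 <= t -> tilt p y x <= p (x + t *: y) - t * p y.
Proof.
move=> t0; apply: ge_inf; last by exists t.
(* The infimum is meaningful because [t * p y = p (t *: y) <= p (x + t *: y) + p (- x)]. *)
exists (- p (- x)) => _ [s /= s0 <-]; rewrite -sublinearZ//.
by have := sp.1 (x + s *: y) (- x); rewrite addrC addKr; lra.
Qed.

Lemma tilt_set_neq0 x :
  [set p (x + t *: y) - t * p y | t in [set t : R | 0 <= t]] !=set0.
Proof. by exists (p (x + 0 *: y) - 0 * p y), 0 => /=. Qed.

Lemma tilt_le x : tilt p y x <= p x.
Proof.
by have := tilt_lbound x (lexx 0); rewrite scale0r addr0 mul0r subr0.
Qed.

Lemma tilt_opp : tilt p y (- y) <= - p y.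
Proof.
have := tilt_lbound (- y) ler01.
by rewrite scale1r addNr mul1r sublinear0// sub0r.
Qed.

(** Parameters [t] for [x] and [u] for [z] combine into [t + u] for [x + z]; [t] for [x] becomes
    [s * t] for [s *: x]. *)
Lemma tilt_sublinear : sublinear (tilt p y).
Proof.
split=> [x z|s x s0].
  rewrite -lerBlDr; apply: lb_le_inf; first exact: tilt_set_neq0.
  move=> _ [t /= t0 <-]; rewrite lerBlDl -lerBlDr.
  apply: lb_le_inf; first exact: tilt_set_neq0.
  move=> _ [u /= u0 <-]; rewrite lerBlDl.
  apply: (le_trans (tilt_lbound _ (addr_ge0 t0 u0))).
  have := sp.1 (x + t *: y) (z + u *: y).
  by rewrite addrACA -scalerDl mulrDl; lra.
apply: le_mul_inf => //; first exact: tilt_set_neq0.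
move=> _ [t /= t0 <-].
apply: (le_trans (tilt_lbound _ (mulr_ge0 s0 t0))).
by rewrite -scalerA -scalerDr sublinearZ// mulrBr mulrA.
Qed.

End Tilt.

(** Zorn's lemma runs over the sublinear functionals below [q], not over partial extensions; a
    minimal one is already linear. *)
Lemma hahn_banach_sublinear (R : realType) (V : lmodType R) (q : V -> R) :
  sublinear q ->
  exists f : V -> R, linear (f : V -> R^o) /\ forall x, f x <= q x.
Proof.
move=> sq; pose P := {p : V -> R | sublinear p /\ forall x, p x <= q x}.
(* The order is reversed, so that a maximal element is a pointwise minimal functional. *)
pose below (p1 p2 : P) := `[< forall x, sval p2 x <= sval p1 x >].
have q0 : P by exists q.
have [||A Atot|[p [sp pq]] pmin] := @ZL_preorder P q0 below.
- by move=> p; apply/asboolP.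
- move=> p1 p2 p3 /asboolP p12 /asboolP p23; apply/asboolP => x.
  exact: le_trans (p23 x) (p12 x).
- have [[a0 Aa0]|A0] := pselect (A !=set0); last first.
    by exists q0 => p Ap; case: A0; exists p.
  pose r x := inf [set sval a x | a in A].
  have r_neq0 x : [set sval a x | a in A] !=set0 by exists (sval a0 x), a0.
  have r_lb a x : A a -> r x <= sval a x.
    move=> Aa; apply: ge_inf; last by exists a.
    exists (- q (- x)) => _ [[p [sp pq]] _ <-] /=.
    by apply: le_trans (sublinear_ge_opp x sp); rewrite lerN2.
  have sr : sublinear r.
    split=> [x y|t x t0].
      rewrite -lerBlDr; apply: lb_le_inf => // _ [a Aa <-].
      rewrite lerBlDl -lerBlDr; apply: lb_le_inf => // _ [b Ab <-].
      rewrite lerBlDl.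
      (* The smaller of two members of the chain serves both arguments of the subadditivity
         estimate. *)
      have [c [Ac ca cb]] : exists c, [/\ A c,
          forall x, sval c x <= sval a x & forall x, sval c x <= sval b x].
        by have [/asboolP ab|/asboolP ba] := Atot a b Aa Ab; [exists b|exists a].
      apply: (le_trans (r_lb _ _ Ac)).
      by apply: (le_trans ((svalP c).1.1 x y)); exact: lerD.
    apply: le_mul_inf => // _ [a Aa <-].
    by apply: (le_trans (r_lb _ _ Aa)); exact: (svalP a).1.2.
  have rq x : r x <= q x.
    by apply: (le_trans (r_lb _ _ Aa0)); exact: (svalP a0).2.
  exists (exist _ r (conj sr rq)) => a Aa; apply/asboolP => x; exact: r_lb.
(* A minimal sublinear functional equals its tilts, hence is odd. *)
exists p; split=> //; apply: sublinear_odd_linear => // y.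
have tq x : tilt p y x <= q x by apply: le_trans (tilt_le y sp x) (pq x).
have /pmin/asboolP/(_ (- y))/= : below (exist _ p (conj sp pq))
    (exist _ (tilt p y) (conj (tilt_sublinear y sp) tq)).
  by apply/asboolP => x; exact: tilt_le.
by move=> /le_trans; apply; exact: tilt_opp.
Qed.

(** A linear [f] below the tilt of the norm at [v] satisfies [f (- v) <= - |v|], hence
    [f v = |v|]. *)
Lemma norming_functional (R : realType) (V : normedModType R) (v : V) :
  exists f : dual V, `|f| <= 1 /\ f v = `|v|.
Proof.
have sn : sublinear (fun x : V => `|x|).
  by split=> [x y|t x t0]; rewrite ?ler_normD// normrZ ger0_norm.
have [f [lf ftilt]] := hahn_banach_sublinear (tilt_sublinear v sn).
pose g : {linear V -> R^o} :=
  HB.pack f (GRing.isLinear.Build R V R^o *:%R f lf).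
have fle x : f x <= `|x| by apply: le_trans (ftilt x) (tilt_le v sn x).
have fN x : f (- x) = - f x by exact: (raddfN g x).
have f_le_norm x : `|f x| <= `|x|.
  by rewrite ler_norml fle andbT; have := fle (- x); rewrite fN normrN; lra.
have bf : (f : V -> R^o) \in bounded_operator V R^o.
  by apply/bounded_operatorP; split=> //; exists 1 => x; rewrite mul1r.
exists (Bop bf); split; first by apply: opnorm_le => // x; rewrite mul1r.
apply/eqP; rewrite eq_le fle/=.
by have := le_trans (ftilt (- v)) (tilt_opp v sn); rewrite fN lerN2.
Qed.

Lemma dual_le_norm (R : realType) (V : normedModType R) (f : dual V) (v : V) :
  `|f| <= 1 -> f v <= `|v|.
Proof.
move=> f1; apply: (le_trans (ler_norm _)); apply: (le_trans (le_opnorm f v)).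
by rewrite -[leRHS]mul1r ler_wpM2r.
Qed.

Lemma norm_elem_tensor (R : realType) (X Y : normedModType R) (x : X) (y : Y) :
  `|elem_tensor x y| = `|x| * `|y|.
Proof.
apply/eqP; rewrite eq_le; apply/andP; split.
  apply: opnorm_le => [|f]; first by rewrite mulr_ge0.
  rewrite /= /elem_tensor_fun normrZ [leRHS]mulrAC ler_wpM2r//.
  by rewrite mulrC; exact: le_opnorm.
have [f [f1 fx]] := norming_functional x.
have := le_opnorm (elem_tensor x y) f.
rewrite /= /elem_tensor_fun fx normrZ normr_id => /le_trans; apply.
rewrite -[leRHS]mulr1; apply: ler_wpM2l => //.
exact: (opnorm_ge0 (elem_tensor x y)).
Qed.

(** * Weak*-continuous functionals as evaluations *)

(** Induction on [s]: if some functional kills [s] but not [x], a multiple of evaluation at [x] is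
    subtracted from [L]; otherwise [x] adds no constraint. *)
Lemma dual_functional_span (R : realType) (X : normedModType R) (s : seq X)
    (L : {linear dual X -> R^o}) :
  (forall f : dual X, (forall x, x \in s -> f x = 0) -> L f = 0) ->
  exists u : X, forall f : dual X, L f = f u.
Proof.
elim: s L => [|x s IH] L Ls.
  by exists 0 => f; rewrite raddf0; exact: Ls.
have [[f0 [f0s f0x]]|all0] :=
    pselect (exists f0 : dual X, (forall z, z \in s -> f0 z = 0) /\ f0 x <> 0).
  pose c := L f0 / f0 x.
  (* L - c ev_x kills f0, hence every f vanishing on s. *)
  pose L' (f : dual X) : R^o := L f - c *: f x.
  have lL' : linear L'.
    move=> t f g; rewrite /L' linearP.
    rewrite -[(t *: f + g) x]/(t *: f x + g x) !scalerDr !scalerA [c * t]mulrC.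
    by rewrite scalerN scalerA opprD addrACA.
  pose gL' : {linear dual X -> R^o} :=
    HB.pack L' (GRing.isLinear.Build R (dual X) R^o *:%R L' lL').
  have [|u' Lu'] := IH gL'.
    move=> f fs; rewrite /= /L'.
    (* The corrected functional vanishes at [x] too, so [L f = (f x / f0 x) * L f0 = c * f x]. *)
    have : L (f - (f x / f0 x) *: f0) = 0.
      apply: Ls => z; rewrite inE => zxs.
      rewrite -[(f - _) z]/(f z - f x / f0 x * f0 z).
      case/predU1P: zxs => [->|zs]; last first.
        by rewrite (fs z)// (f0s z)// mulr0 subr0.
      by rewrite divfK ?subrr//; exact/eqP.
    rewrite linearB linearZ/= => /eqP; rewrite subr_eq0 => /eqP ->.
    apply/eqP; rewrite subr_eq0; apply/eqP.
    rewrite -[LHS]/(f x / f0 x * L f0) -[RHS]/(L f0 / f0 x * f x).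
    by rewrite [LHS]mulrC mulrA mulrAC.
  exists (u' + c *: x) => f; rewrite raddfD/= linearZ/=.
  by rewrite -(Lu' f) /= /L' subrK.
apply: IH => f fs; apply: Ls => z; rewrite inE => /predU1P[->|/fs//].
by apply: contrapT => fx; apply: all0; exists f.
Qed.

(** Continuity of [T] makes its adjoint send the dual of [Y] into [X] rather than merely into the
    bidual. *)
Lemma weak_star_continuous_adjoint (R : realType) (X Y : normedModType R)
    (T : 'L(dual X, Y)) (g : dual Y) :
  weak_star_to_weak_continuous T ->
  exists u : X, forall f : dual X, g (T f) = f u.
Proof.
move=> cT.
(* The subspaces K s generate a filter converging weak* to 0, so g o T is
   bounded by 1 on some K s and, by homogeneity, vanishes there. *)
pose K (s : seq X) := [set f : dual X | forall x, x \in s -> f x = 0].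
pose F : set_system (dual X) := filter_from [set: seq X] K.
have FF : Filter F.
  apply: filter_from_filter; first by exists [::].
  move=> s1 s2 _ _; exists (s1 ++ s2) => // f fs.
  by split=> x xs; apply: fs; rewrite mem_cat xs ?orbT.
have F0 : F --> (0 : weak_star X).
  move=> A; rewrite nbhsE => -[_ [[B oB <-] B0] BA].
  have Fp x : (fun f : X -> R^o => f x) @
      ((fun f : dual X => (f : X -> R^o)) @ F) --> (0 : R^o).
    move=> C /nbhs_singleton C0; exists [:: x] => // f fx.
    by rewrite /= fx// inE.
  have /pointwise_cvgP/(_ B) Fpt := Fp.
  by apply: filterS BA (Fpt _); apply: open_nbhs_nbhs; split.
have TF : T @ F --> (T 0 : weak Y) by move=> A /cT; exact: F0.
have TF' : (fun f : dual X => (fun h : dual Y => h (T f) : R^o)) @ F -->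
    ((fun h : dual Y => h (T 0)) : {ptws dual Y -> R^o}).
  pose ev (v : Y) : {ptws dual Y -> R^o} := fun h => h v.
  move=> A nA; exact: (TF (ev @^-1` A) (@initial_continuous Y _ ev (T 0) A nA)).
move/pointwise_cvgP : TF' => /(_ g) gTF.
have gT0 : g (T 0) = 0 by rewrite !raddf0.
have [s _ sg] : F [set f | `|g (T f)| < 1].
  have FB : F [set f : dual X | ball (g (T 0) : R^o) 1 (g (T f))].
    exact: gTF (nbhsx_ballx _ _ ltr01).
  by apply: filterS FB => f; rewrite /ball/= gT0 sub0r normrN.
pose L (f : dual X) : R^o := g (T f).
have lL : linear L by move=> t f h; rewrite /L !linearP.
pose gL : {linear dual X -> R^o} :=
  HB.pack L (GRing.isLinear.Build R (dual X) R^o *:%R L lL).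
apply: (@dual_functional_span R X s gL) => f fs.
apply/eqP/negPn/negP => /= Lf0.
have /sg/= : K s ((L f)^-1 *: f).
  by move=> x xs; rewrite -[LHS]/((L f)^-1 * f x) (fs x)// mulr0.
rewrite -[g _]/(gL ((L f)^-1 *: f)) linearZ/=.
by rewrite -[_ *: _]/((L f)^-1 * L f) mulVf// normr1 ltxx.
Qed.

(** * Octahedrality of [X] applied to adjoint vectors *)

Lemma bop_le_norm (R : realType) (V W : normedModType R)
    (T : 'L(V, W)) (v : V) :
  `|v| <= 1 -> `|T v| <= `|T|.
Proof.
move=> v1; apply: (le_trans (le_opnorm T v)).
by rewrite -[leRHS]mulr1; apply: ler_wpM2l => //; exact: opnorm_ge0.
Qed.

(** Normalizing moves [u i] by [1 - |u i| < d], which costs a second [d] besides that of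
    octahedrality. *)
Lemma octahedral_near_sphere (R : realType) (X : normedModType R) (n : nat)
    (u : 'I_n -> X) (d : R) :
  octahedral [set: X] -> 0 < d < 1 -> (forall i, 1 - d < `|u i| <= 1) ->
  exists x : X, `|x| = 1 /\ forall i, 2 - 2 * d < `|u i + x|.
Proof.
move=> oX /andP[d0 d1] ud.
have u0 i : 0 < `|u i| by have /andP[+ _] := ud i; lra.
have [|x [_ x1 ux]] := oX n (fun i => `|u i|^-1 *: u i) d _ d0.
  move=> i; split=> //; rewrite normrZ normfV normr_id mulVf//.
  exact: lt0r_neq0.
exists x; split=> // i.
have := ler_normD (u i + x) (`|u i|^-1 *: u i - u i).
rewrite addrC addrA subrK.
have -> : `|u i|^-1 *: u i - u i = ((1 - `|u i|) / `|u i|) *: u i.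
  by rewrite mulrBl mul1r divff ?lt0r_neq0// scalerBl scale1r.
have /andP[ud1 ud2] := ud i.
rewrite normrZ normrM normfV normr_id divfK ?lt0r_neq0// ger0_norm ?subr_ge0//.
by have := ux i; lra.
Qed.

(** [G] is a norming part of the dual ball: the whole ball in case (i), [states y] in case (ii). If
    [f] nearly attains [|T|], then [1 - d < |g (T f)| = |f u| <= |u|]; a functional [h] norming [u]
    gives [|u| = g (T h) <= |T|]. *)
Lemma adjoint_norm_near1 (R : realType) (X Y : normedModType R)
    (G : set (dual Y)) (T : 'L(dual X, Y)) (d : R) :
  (forall g, G g -> `|g| <= 1) ->
  (forall (v : Y) a, a < `|v| -> exists2 g, G g & a < `|g v|) ->
  weak_star_to_weak_continuous T -> `|T| = 1 -> 0 < d ->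
  exists (g : dual Y) (u : X),
    [/\ G g, forall f, g (T f) = f u & 1 - d < `|u| <= 1].
Proof.
move=> G1 Gnorming cT T1 d0.
have [_ [f /= f1 <-]] := sup_adherent d0 (opnorm_has_sup T).
rewrite -[sup _]/(`|T|) T1 => /Gnorming[g Gg gTf].
have [u gu] := weak_star_continuous_adjoint g cT.
exists g, u; split=> //; apply/andP; split.
  apply: (lt_le_trans gTf); rewrite gu; apply: (le_trans (le_opnorm f u)).
  by rewrite -[leRHS]mul1r; apply: ler_wpM2r.
have [h [h1 <-]] := norming_functional u.
rewrite -gu; apply: (le_trans (dual_le_norm _ (G1 _ Gg))).
by rewrite -T1; exact: bop_le_norm.
Qed.

Lemma octahedral_adjoints (R : realType) (X Y : normedModType R)
    (G : set (dual Y)) (n : nat) (T : 'I_n -> 'L(dual X, Y)) (d : R) :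
  (forall g, G g -> `|g| <= 1) ->
  (forall (v : Y) a, a < `|v| -> exists2 g, G g & a < `|g v|) ->
  octahedral [set: X] ->
  (forall i, weak_star_to_weak_continuous (T i) /\ `|T i| = 1) -> 0 < d < 1 ->
  exists x : X, `|x| = 1 /\ forall i, exists (g : dual Y) (u : X),
    [/\ G g, forall f, g (T i f) = f u, `|u| <= 1 & 2 - 2 * d < `|u + x|].
Proof.
move=> G1 Gnorming oX cT d01; have /andP[d0 _] := d01.
have /choice[u uT] : forall i, exists u : X, exists g : dual Y,
    [/\ G g, forall f, g (T i f) = f u & 1 - d < `|u| <= 1].
  move=> i; have [cTi T1] := cT i.
  by have [g [u ?]] := adjoint_norm_near1 G1 Gnorming cTi T1 d0; exists u, g.
have [|x [x1 ux]] := octahedral_near_sphere (u := u) oX d01.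
  by move=> i; have [g []] := uT i.
exists x; split=> // i; have [g [Gg gT /andP[_ u1]]] := uT i.
by exists g, (u i).
Qed.

Lemma elem_tensor_in_tensor_product (R : realType) (X Y : normedModType R)
    (x : X) (y : Y) : tensor_product X Y (elem_tensor x y).
Proof. by exists 1, (fun=> x), (fun=> y); rewrite big_ord1. Qed.

(** The numerical index is attained, so the value 1 bounds [|v|] by the supremum over [states y]. *)
Lemma numerical_index1_norming (R : realType) (Y : normedModType R) (y : Y) :
  `|y| = 1 -> numerical_index y = 1 ->
  forall (v : Y) (a : R), a < `|v| -> exists2 g, states y g & a < `|g v|.
Proof.
move=> y1 ny v a av.
have [[_ /(_ v)]] := numerical_index_largest y1; rewrite ny mul1r => vsup _.
have [|_ [g yg <-] ag] := sup_gt _ (lt_le_trans av vsup); last by exists g.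
(* Taking this supremum needs a state to exist: a functional norming [y] is one. *)
have [g [g1 gy]] := norming_functional y.
by exists `|g v|, g => //; split=> //; rewrite gy.
Qed.

(** * The two octahedrality results for [H] *)

Section OctahedralOperators.
Context {R : realType} {X Y : normedModType R} (H : set 'L(dual X, Y)).
Hypothesis H_tensor : tensor_product X Y `<=` H.
Hypothesis H_cont :
  forall T : 'L(dual X, Y), H T -> weak_star_to_weak_continuous T.

Lemma octahedral_operators :
  octahedral [set: X] -> octahedral [set: Y] -> octahedral H.
Proof.
move=> oX oY n T e HT e0.
(* Octahedrality of [Y] is used with [2 * d], which must stay below 1, and loses [4 * d]; replacing
   [z i x] by 1 loses another [2 * d]. *)
pose d : R := Num.min (1 / 3) (e / 6).
have d0 : 0 < d by rewrite lt_min; lra.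
have [d3 d6] : d <= 1 / 3 /\ d <= e / 6 by rewrite !ge_min !lexx orbT.
have [||||x [x1 xT]] := @octahedral_adjoints _ X Y
    [set g | `|g| <= 1] n T d _ _ oX _ _ => //.
- move=> v a av; have [g [g1 gv]] := norming_functional v.
  by exists g => //; rewrite gv normr_id.
- by move=> i; have [HTi T1] := HT i; split=> //; exact: H_cont.
- lra.
have /choice[z zT] i : exists z : dual X,
    [/\ `|z| <= 1, 1 - 2 * d < z x <= 1 & 1 - 2 * d < `|T i z| <= 1].
  have [g [u [g1 gT u1 ux]]] := xT i.
  (* [z u + z x > 2 - 2 * d] with both terms at most 1, so each exceeds [1 - 2 * d]; moreover
     [z u = g (T i z) <= |T i z|]. *)
  have [z [z1]] := norming_functional (u + x); rewrite raddfD/= => zux.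
  have zu := dual_le_norm u z1; have := dual_le_norm x z1; rewrite x1 => zx.
  have zTz := dual_le_norm (T i z) g1.
  have := bop_le_norm (T i) z1; have [_ ->] := HT i => Tz1.
  move: zTz; rewrite gT => zTz.
  by exists z; split=> //; apply/andP; split=> //; lra.
have [||y [y1 yT]] :=
    @octahedral_near_sphere _ Y n (fun i => T i (z i)) (2 * d) oY.
- lra.
- by move=> i; have [] := zT i.
exists (elem_tensor x y); split.
- exact/H_tensor/elem_tensor_in_tensor_product.
- by rewrite norm_elem_tensor x1 y1 mulr1.
move=> i; have [z1 /andP[zx zx1] _] := zT i.
have := bop_le_norm (T i + elem_tensor x y) z1.
have -> : (T i + elem_tensor x y) (z i) = (T i (z i) + y) - (1 - z i x) *: y.
  rewrite scalerBl scale1r opprB addrA addrAC addrK.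
  by rewrite -[LHS]/(T i (z i) + z i x *: y).
have := lerB_dist (T i (z i) + y) ((1 - z i x) *: y).
rewrite normrZ y1 mulr1 ger0_norm ?subr_ge0//.
by have := yT i; lra.
Qed.

Lemma octahedral_operators_numerical_index (y : Y) :
  octahedral [set: X] -> `|y| = 1 -> numerical_index y = 1 -> octahedral H.
Proof.
move=> oX y1 ny n T e HT e0.
(* Only the loss [2 * d] from [octahedral_adjoints] occurs here; [1 / 2] keeps [d] below 1. *)
pose d : R := Num.min (1 / 2) (e / 2).
have d0 : 0 < d by rewrite lt_min; lra.
have [d2 de] : d <= 1 / 2 /\ d <= e / 2 by rewrite !ge_min !lexx orbT.
have [||||x [x1 xT]] := @octahedral_adjoints _ X Y (states y) n T d _ _ oX.
- by move=> g [].
- exact: numerical_index1_norming.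
- by move=> i; have [HTi T1] := HT i; split=> //; exact: H_cont.
- lra.
exists (elem_tensor x y); split.
- exact/H_tensor/elem_tensor_in_tensor_product.
- by rewrite norm_elem_tensor x1 y1 mulr1.
move=> i; have [g [u [[g1 gy] gT u1 ux]]] := xT i.
have [z [z1 zux]] := norming_functional (u + x).
have zTz := dual_le_norm ((T i + elem_tensor x y) z) g1.
have := bop_le_norm (T i + elem_tensor x y) z1.
(* Since [g y = 1], the left side is [z u + z x = z (u + x)], with no error term. *)
have gTz : g ((T i + elem_tensor x y) z) = `|u + x|.
  rewrite -[(T i + _) z]/(T i z + z x *: y) (raddfD g) /= gT.
  rewrite (linearZZ g (z x) y : _ = z x * g y) gy mulr1.
  by rewrite -zux raddfD.
by move: zTz; rewrite gTz; lra.
Qed.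

End OctahedralOperators.

Theorem theorem2p2 (R : realType) (X Y : completeNormedModType R)
    (X_neq0 : exists x : X, x <> 0) (Y_neq0 : exists y : Y, y <> 0)
    (H : set 'L(dual X, Y))
    (H_subspace : linear_subspace H) (H_closed : closed H)
    (H_tensor : tensor_product X Y `<=` H)
    (H_cont : forall T : 'L(dual X, Y), H T -> weak_star_to_weak_continuous T) :
  (octahedral [set: X] -> octahedral [set: Y] -> octahedral H) /\
  (octahedral [set: X] ->
   (exists y : Y, `|y| = 1 /\ numerical_index y = 1) -> octahedral H).
Proof.
split; first exact: octahedral_operators.
by move=> oX [y [y1 ny]]; exact: octahedral_operators_numerical_index ny.
Qed.
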